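(* Let $H_1, H_2$ be graphs. Then the class of $\{H_1, H_2\}$-free graphs is bounded-apex-complete-multipartite if and only if, up to switching the names of $H_1$ and $H_2$, one of the following holds: 1. $H_1$ is an induced subgraph of $K_2 + K_1$; or 2. $H_1$ is a complete graph and $H_2$ is edgeless.
   Context: All graphs are finite and simple. $K_2+K_1$ is the disjoint union of an edge and a single vertex. ''Induced subgraph of $X$'' means isomorphic to $X[S]$ for some $S\subseteq V(X)$. For a set $\mathcal{H}$ of graphs, a graph is $\mathcal{H}$-free if none of its induced subgraphs is isomorphic to a graph in $\mathcal{H}$. A graph $G$ is complete multipartite if $V(G)$ can be partitioned into sets $V_1,\dots,V_k$, $k\ge 1$, such that for all $u\in V_i$, $v\in V_j$, we have $uv\in E(G)$ if and only if $i\ne j$. A class of graphs is bounded-apex-complete-multipartite if there is a constant $c\in\mathbb{N}$ such that every graph $G$ in the class has a set $S\subseteq V(G)$ with $|S|\le c$ such that $G-S$ is complete multipartite. *)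

(* Defs.v *)
From mathcomp Require Import all_boot.

Set Implicit Arguments.
Unset Strict Implicit.
Unset Printing Implicit Defensive.

Record sgraph := SGraph {
  vertex :> finType;
  adj : rel vertex;
  adj_sym : symmetric adj;
  adj_irr : irreflexive adj
}.

Definition graph_iso (G H : sgraph) : Prop :=
  exists f : G -> H, bijective f /\ {mono f : x y / adj x y}.

Section Induced.
Variables (G : sgraph) (S : {set G}).

Definition induced_adj : rel {x : G | x \in S} :=
  [rel x y | adj (val x) (val y)].

Lemma induced_sym : symmetric induced_adj.
Proof. by move=> x y; apply: adj_sym. Qed.

Lemma induced_irr : irreflexive induced_adj.
Proof. by move=> x; apply: adj_irr. Qed.

Definition induced : sgraph := SGraph induced_sym induced_irr.

End Induced.

Definition delete_vertices (G : sgraph) (S : {set G}) : sgraph :=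
  induced (~: S).

Definition induced_subgraph (H G : sgraph) : Prop :=
  exists S : {set G}, graph_iso H (induced S).

Section Complete.
Variable n : nat.

Definition complete_adj : rel 'I_n := [rel x y | x != y].

Lemma complete_sym : symmetric complete_adj.
Proof. by move=> x y; rewrite /complete_adj /= eq_sym. Qed.

Lemma complete_irr : irreflexive complete_adj.
Proof. by move=> x; rewrite /complete_adj /= eqxx. Qed.

Definition complete_graph : sgraph := SGraph complete_sym complete_irr.

End Complete.

Section DisjointUnion.
Variables G H : sgraph.

Definition union_adj : rel (G + H)%type := fun x y =>
  match x, y with
  | inl a, inl b => adj a b
  | inr a, inr b => adj a b
  | _, _ => false
  end.

Lemma union_sym : symmetric union_adj.
Proof. by move=> [x|x] [y|y] //; apply: adj_sym. Qed.

Lemma union_irr : irreflexive union_adj.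
Proof. by move=> [x|x]; apply: adj_irr. Qed.

Definition disjoint_union : sgraph := SGraph union_sym union_irr.

End DisjointUnion.

Definition K2_plus_K1 : sgraph :=
  disjoint_union (complete_graph 2) (complete_graph 1).

Definition is_complete (G : sgraph) : Prop :=
  forall x y : G, x != y -> adj x y.

Definition is_edgeless (G : sgraph) : Prop :=
  forall x y : G, ~~ adj x y.

Definition free (Hs : sgraph -> Prop) (G : sgraph) : Prop :=
  forall H : sgraph, Hs H -> ~ induced_subgraph H G.

Definition pair_class (H1 H2 : sgraph) : sgraph -> Prop :=
  fun H => H = H1 \/ H = H2.

(* The parts V i may be empty, so the graph with no vertices is complete
   multipartite (take k = 1).  For graphs with at least one vertex, requiring
   nonempty parts would define the same notion. *)
Definition complete_multipartite (G : sgraph) : Prop :=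
  exists (k : nat) (V : 'I_k -> {set G}),
    [/\ 0 < k,
        \bigcup_(i < k) V i = [set: G],
        forall i j, i != j -> [disjoint V i & V j] &
        forall i j u v, u \in V i -> v \in V j -> adj u v = (i != j)].

Definition bounded_apex_complete_multipartite (C : sgraph -> Prop) : Prop :=
  exists c : nat, forall G : sgraph, C G ->
    exists S : {set G},
      #|S| <= c /\ complete_multipartite (delete_vertices S).

(* Main.v *)
Require Import Defs.
From mathcomp Require Import all_boot.

Set Implicit Arguments.
Unset Strict Implicit.
Unset Printing Implicit Defensive.

(** A graph is complete multipartite exactly when non-adjacency is transitive,
that is, when it has no induced K2 + K1.  A bounded apex set is therefore a
bounded set of vertices that meets every induced K2 + K1.

Sufficiency.  If H1 embeds in K2 + K1 then an H1-free graph has no induced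
K2 + K1, and the empty apex set works.  If H1 is complete and H2 is edgeless
then Ramsey's theorem bounds the order of the {H1, H2}-free graphs, and the
whole vertex set works.

Necessity.  Put n copies of K2 + K1 side by side and join distinct copies in a
uniform way, by a fixed symmetric relation r on the three vertex types.  Fewer
than n deletions leave one copy untouched (copies_large_apex).  So if the class
is bounded then, for n large and every r, H1 or H2 embeds in the result
(bounded_apex_embeds_copies).  Six relations suffice:
- apart: n disjoint copies, a graph of maximum degree 1;
- joined: all edges between copies, the complement of n disjoint P3;
- two_cliques: two disjoint cliques;
- one_clique: a clique and isolated vertices;
- fibre_adj: a balanced complete bipartite graph and isolated vertices;
- across: a complete bipartite graph minus a matching.

Say that H1 embeds in the first of these.  If it also embeds in the second then
it has maximum degree at most 1 and neither 3K1 nor 2K2, hence it embeds in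
K2 + K1 (embeds_co_P3).  Otherwise H2 embeds in the second, and then H2 embeds
in K2 + K1 as soon as it has neither an induced P3 nor a triangle.  Assume that
neither graph embeds in K2 + K1; then H1 contains 3K1 or 2K2.
- If H1 has no 3K1 then it has 2K2, so it embeds neither in one_clique nor in
  fibre_adj.  Hence H2 embeds in both, is P3-free and triangle-free, and this is
  excluded.
- If H1 has 3K1 then two_cliques forces H2 to be P3-free, hence to have a
  triangle, and P3-freeness together with K3 + K1-freeness makes H2 complete.
  As across is triangle-free, it must contain H1; it has no induced K2 + 2K1,
  and a graph of maximum degree 1 that has 3K1 and an edge has K2 + 2K1, so H1
  is edgeless. *)

(** * Induced subgraphs as embeddings *)

Definition embeds (H G : sgraph) : Prop :=
  exists f : H -> G, injective f /\ {mono f : x y / adj x y}.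

Lemma induced_subgraphE (H G : sgraph) : induced_subgraph H G <-> embeds H G.
Proof.
split=> [[S [f [bij_f mono_f]]]|[f [inj_f mono_f]]].
  exists (fun x => val (f x)); split=> [x y /val_inj|x y]; first exact: bij_inj.
  exact: mono_f.
pose S := [set f x | x : H].
have fS x : f x \in S by apply: imset_f.
pose g x : induced S := Sub (f x) (fS x).
have inj_g : injective g by move=> x y /(congr1 val) /inj_f.
exists S, g; split; last by move=> x y; exact: mono_f.
by apply: inj_card_bij; rewrite //= card_sig card_imset.
Qed.

(** Lets the necessity proof extract, without classical logic, an embedding of
H1 or H2 from the fact that some graph is not free. *)
Lemma embedsP (H G : sgraph) :
  reflect (embeds H G)
    [exists f : {ffun H -> G},
      injectiveb f && [forall x, forall y, adj (f x) (f y) == adj x y]].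
Proof.
apply: (iffP existsP) => [[f /andP[/injectiveP inj_f /'forall_'forall_eqP mono_f]]
                         |[f [inj_f mono_f]]].
  by exists f.
exists (finfun f); apply/andP; split.
  by apply/injectiveP => x y; rewrite !ffunE => /inj_f.
by apply/'forall_'forall_eqP => x y; rewrite !ffunE.
Qed.

Lemma embeds_trans (F G H : sgraph) : embeds F G -> embeds G H -> embeds F H.
Proof.
move=> [f [inj_f mono_f]] [g [inj_g mono_g]].
exists (g \o f); split; first exact: inj_comp.
by move=> x y; rewrite /= mono_g mono_f.
Qed.

Lemma induced_embeds (G : sgraph) (S : {set G}) : embeds (induced S) G.
Proof. by exists val; split=> //; apply: val_inj. Qed.

(** * Complete multipartite graphs *)

(** K2 + K1 is the complement of the path P3.  For z = x or z = y the condition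
repeats the adjacency of x and y. *)
Definition co_P3_free (G : sgraph) : Prop :=
  forall x y z : G, adj x y -> adj z x || adj z y.

Lemma complete_multipartiteE (G : sgraph) :
  complete_multipartite G <-> co_P3_free G.
Proof.
split=> [[k [V [_ cover_V _ adj_V]]] x y z xy|noP3].
  have part u : exists i, u \in V i.
    by have := in_setT u; rewrite -cover_V => /bigcupP[i _]; exists i.
  have [[[i xi] [j yj]] [l zl]] := (part x, part y, part z).
  move: xy; rewrite (adj_V _ _ _ _ xi yj) (adj_V _ _ _ _ zl xi).
  rewrite (adj_V _ _ _ _ zl yj) -negb_and.
  by apply: contra => /andP[/eqP <- /eqP <-].
(* When non-adjacency is transitive it is an equivalence relation, and the parts
   are its classes N x.  Indexing them by all vertex sets leaves most parts
   empty but keeps the number of parts positive. *)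
pose N (x : G) := [set y | ~~ adj x y].
have N_adj u v : adj u v = (N u != N v).
  apply/idP/idP => [uv|].
    apply/eqP => /setP /(_ v).
    by rewrite !inE uv adj_irr.
  apply: contraNT => uv; apply/eqP/setP => w; rewrite !inE; congr (~~ _).
  apply/idP/idP => [/(noP3 u w v)|/(noP3 v w u)].
    by rewrite adj_sym (negPf uv).
  by rewrite (negPf uv).
exists #|{set G}|, (fun i => [set x | N x == enum_val i]); split.
- by apply/card_gt0P; exists set0.
- apply/setP => x; rewrite inE; apply/bigcupP.
  by exists (enum_rank (N x)); rewrite // inE enum_rankK.
- move=> i j ij; apply/pred0P => x /=; rewrite !inE.
  apply/negP => /andP[/eqP -> /eqP /enum_val_inj eij].
  by rewrite eij eqxx in ij.
move=> i j u v; rewrite !inE N_adj => /eqP -> /eqP ->.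
by rewrite (inj_eq enum_val_inj).
Qed.

Lemma co_P3_free_of_not_embeds (G : sgraph) :
  ~ embeds K2_plus_K1 G -> co_P3_free G.
Proof.
move=> noK x y z xy; apply: contraT => /norP[zx zy]; case: noK.
exists (fun v : K2_plus_K1 => match v with
  | inl i => if i == ord0 then x else y
  | inr _ => z end).
have [x_z y_z x_y] : [/\ x != z, y != z & x != y].
  split; apply/eqP => e.
  - by rewrite -e xy in zy.
  - by rewrite -e adj_sym xy in zx.
  - by rewrite e adj_irr in xy.
split.
  move=> [[[|[|//]] ?]|[[|//] ?]] [[[|[|//]] ?]|[[|//] ?]] //= /eqP;
    first [by move=> _; congr (_ _); apply: val_inj
    | by rewrite ?(negPf x_z) ?(negPf y_z) ?(negPf x_y)
    | by rewrite eq_sym ?(negPf x_z) ?(negPf y_z) ?(negPf x_y)].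
move=> [[[|[|//]] ?]|[[|//] ?]] [[[|[|//]] ?]|[[|//] ?]] //=;
  by rewrite ?adj_irr // ?xy ?(negPf zx) ?(negPf zy) // adj_sym
       ?xy ?(negPf zx) ?(negPf zy).
Qed.

(** * Ramsey's theorem for two colours *)

Definition clique (G : sgraph) (K : {set G}) : Prop :=
  {in K &, forall x y, x != y -> adj x y}.

Definition stable (G : sgraph) (K : {set G}) : Prop :=
  {in K &, forall x y, ~~ adj x y}.

(** The usual recurrence R(m+1, n+1) <= R(m, n+1) + R(m+1, n) + 1: a vertex x of A
splits the rest of A into its neighbours and its non-neighbours, and x extends
a clique of the former or a stable set of the latter.  The statement is relative
to a subset A so that the induction stays inside one graph. *)
Lemma ramsey (m n : nat) : exists N, forall (G : sgraph) (A : {set G}),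
  N <= #|A| -> exists2 K : {set G}, K \subset A &
    (m <= #|K| /\ clique K) \/ (n <= #|K| /\ stable K).
Proof.
elim: m n => [|m IHm] n.
  exists 0 => G A _; exists set0; first exact: sub0set.
  by left; split=> // x; rewrite inE.
elim: n => [|n [N2 IHn]].
  exists 0 => G A _; exists set0; first exact: sub0set.
  by right; split=> // x; rewrite inE.
have [N1 {}IHm] := IHm n.+1.
exists (N1 + N2).+1 => G A leA.
have /card_gt0P[x xA] : 0 < #|A| by apply: leq_trans leA.
pose B := [set y in A :\ x | adj x y]; pose C := [set y in A :\ x | ~~ adj x y].
have cardBC : #|A| = (#|B| + #|C|).+1.
  rewrite (cardsD1 x) xA add1n; congr _.+1.
  rewrite -(cardsID [set y | adj x y] (A :\ x)); congr (_ + _).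
    by apply: eq_card => y; rewrite !inE.
  by apply: eq_card => y; rewrite !inE andbC.
have subB : B \subset A by apply/subsetP => y; rewrite !inE => /andP[/andP[]].
have subC : C \subset A by apply/subsetP => y; rewrite !inE => /andP[/andP[]].
have [leB|ltB] := leqP N1 #|B|.
  have [K KB [[leK cK]|[leK sK]]] := IHm G B leB; last first.
    by exists K; [apply: subset_trans subB | right].
  have xK y : y \in K -> adj x y.
    by move=> /(subsetP KB); rewrite !inE => /andP[].
  exists (x |: K).
    by rewrite subUset sub1set xA (subset_trans KB).
  left; split.
    rewrite cardsU1; case: (boolP (x \in K)) => [/xK|_ //].
    by rewrite adj_irr.
  move=> y z; rewrite !inE => /predU1P[->|yK] /predU1P[->|zK].
  - by rewrite eqxx.
  - by move=> _; apply: xK.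
  - by move=> _; rewrite adj_sym; apply: xK.
  - exact: cK.
have leC : N2 <= #|C|.
  rewrite cardBC ltnS in leA.
  by rewrite -(leq_add2l N1); apply: leq_trans leA _; rewrite leq_add2r ltnW.
have [K KC [[leK cK]|[leK sK]]] := IHn G C leC.
  by exists K; [apply: subset_trans subC | left].
have xK y : y \in K -> (y != x) && ~~ adj x y.
  by move=> /(subsetP KC); rewrite !inE => /andP[/andP[-> _] ->].
exists (x |: K).
  by rewrite subUset sub1set xA (subset_trans KC).
right; split.
  rewrite cardsU1; case: (boolP (x \in K)) => [/xK|_ //].
  by rewrite eqxx.
move=> y z; rewrite !inE => /predU1P[->|yK] /predU1P[->|zK].
- by rewrite adj_irr.
- by have /andP[] := xK _ zK.
- by rewrite adj_sym; have /andP[] := xK _ yK.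
- exact: sK.
Qed.

Lemma injection_into_set (H G : finType) (K : {set G}) :
  #|H| <= #|K| -> exists2 f : H -> G, injective f & forall x, f x \in K.
Proof.
move=> leHK; exists (fun x => enum_val (widen_ord leHK (enum_rank x))).
  by move=> x y /enum_val_inj /(congr1 val) /= /val_inj /enum_rank_inj.
by move=> x; apply: enum_valP.
Qed.

Lemma complete_embeds_clique (H G : sgraph) (K : {set G}) :
  is_complete H -> #|H| <= #|K| -> clique K -> embeds H G.
Proof.
move=> compH /injection_into_set[f inj_f fK] cK; exists f; split=> // x y.
have [->|xy] := eqVneq x y; first by rewrite !adj_irr.
by rewrite compH // cK // (inj_eq inj_f).
Qed.

Lemma edgeless_embeds_stable (H G : sgraph) (K : {set G}) :
  is_edgeless H -> #|H| <= #|K| -> stable K -> embeds H G.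
Proof.
move=> edgH /injection_into_set[f inj_f fK] sK; exists f; split=> // x y.
by rewrite (negPf (edgH x y)) (negPf (sK _ _ (fK x) (fK y))).
Qed.

(** * The two sufficient conditions *)

Lemma bounded_apex_of_sub_co_P3 (H1 H2 : sgraph) :
  embeds H1 K2_plus_K1 ->
  bounded_apex_complete_multipartite (free (pair_class H1 H2)).
Proof.
move=> H1K; exists 0 => G freeG; exists set0; rewrite cards0; split=> //.
apply/complete_multipartiteE/co_P3_free_of_not_embeds => KG.
apply: (freeG H1); first by left.
apply/induced_subgraphE/(embeds_trans H1K)/(embeds_trans KG).
exact: induced_embeds.
Qed.

Lemma bounded_apex_of_complete_edgeless (H1 H2 : sgraph) :
  is_complete H1 -> is_edgeless H2 ->
  bounded_apex_complete_multipartite (free (pair_class H1 H2)).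
Proof.
move=> compH1 edgH2; have [N ramseyN] := ramsey #|H1| #|H2|.
exists N => G freeG; exists setT; split.
  rewrite leqNgt; apply/negP => /ltnW /ramseyN[K _ [[leK cK]|[leK sK]]].
    apply: (freeG H1); first by left.
    exact/induced_subgraphE/(complete_embeds_clique _ leK).
  apply: (freeG H2); first by right.
  exact/induced_subgraphE/(edgeless_embeds_stable _ leK).
apply/complete_multipartiteE => -[x x0] y z.
by exfalso; move: x0; rewrite !inE.
Qed.

(** * Uniform arrangements of many copies of the forbidden graph *)

(** K2 + K1 on the type option bool, which case analysis computes with: the edge
joins the two vertices Some _, and None is the isolated vertex. *)
Definition fibre_adj : rel (option bool) := fun s t =>
  match s, t with Some a, Some b => a != b | _, _ => false end.

(** Distinct copies are joined according to r, which only sees the position of a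
vertex in its copy. *)
Section Copies.
Variables (n : nat) (r : rel (option bool)).
Hypothesis r_sym : symmetric r.

Definition copies_adj : rel ('I_n * option bool) := fun u v =>
  if u.1 == v.1 then fibre_adj u.2 v.2 else r u.2 v.2.

Lemma copies_sym : symmetric copies_adj.
Proof.
move=> [i s] [j t]; rewrite /copies_adj /= eq_sym r_sym.
by case: s t => [[]|] [[]|].
Qed.

Lemma copies_irr : irreflexive copies_adj.
Proof. by move=> [i [[]|]]; rewrite /copies_adj /= eqxx. Qed.

Definition copies : sgraph := SGraph copies_sym copies_irr.

(** By pigeonhole some copy avoids S, and it is an induced K2 + K1 of the rest. *)
Lemma copies_large_apex (S : {set copies}) :
  #|S| < n -> ~ complete_multipartite (delete_vertices S).
Proof.
move=> ltSn /complete_multipartiteE noP3.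
pose index (u : copies) : 'I_n := u.1.
have [i iS] : exists i, i \notin [set index u | u in S].
  apply/existsP; rewrite -negb_forall; apply/negP => /forallP allS.
  have: #|'I_n| <= #|[set index u | u in S]|.
    by apply/subset_leq_card/subsetP => i _.
  by rewrite card_ord leqNgt (leq_ltn_trans (leq_imset_card _ _)).
have notS s : (i, s) \in ~: S.
  by rewrite inE; apply: contra iS => iS; apply/imsetP; exists (i, s).
pose v s : delete_vertices S := Sub ((i, s) : copies) (notS s).
have := noP3 (v (Some true)) (v (Some false)) (v None).
by rewrite /= /induced_adj /= /copies_adj /= eqxx => /(_ isT).
Qed.

End Copies.

(** With n larger than the bound, the arrangement of n copies violates the
bound, so it cannot be {H1, H2}-free. *)
Lemma bounded_apex_embeds_copies (H1 H2 : sgraph) :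
  bounded_apex_complete_multipartite (free (pair_class H1 H2)) ->
  exists n, forall (r : rel (option bool)) (r_sym : symmetric r),
    embeds H1 (copies n r_sym) \/ embeds H2 (copies n r_sym).
Proof.
move=> [c bnd]; exists c.+1 => r r_sym.
have [|no1] := embedsP H1 (copies c.+1 r_sym); first by left.
have [|no2] := embedsP H2 (copies c.+1 r_sym); first by right.
have [H [->|->] /induced_subgraphE //|S [leS]] := bnd (copies c.+1 r_sym).
by move=> /copies_large_apex; rewrite ltnS leS => /(_ isT).
Qed.

(** * Hereditary properties *)

(** Maximum degree at most 1. *)
Definition matching (G : sgraph) : Prop :=
  forall x y z : G, adj x y -> adj x z -> y = z.

Definition triangle_free (G : sgraph) : Prop :=
  forall x y z : G, adj x y -> adj y z -> ~~ adj x z.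

Definition P3_free (G : sgraph) : Prop :=
  forall x y z : G, adj x y -> adj y z -> (x == z) || adj x z.

(** Distinctness of the three vertices has to be assumed here, whereas in
free_2K2 and free_K3_K1 it follows from the required adjacencies and
non-adjacencies. *)
Definition free_3K1 (G : sgraph) : Prop :=
  forall x y z : G, x != y -> x != z -> y != z ->
    [|| adj x y, adj x z | adj y z].

Definition free_2K2 (G : sgraph) : Prop :=
  forall x y z w : G, adj x y -> adj z w ->
    [|| adj x z, adj x w, adj y z | adj y w].

Definition free_K3_K1 (G : sgraph) : Prop :=
  forall x y z w : G, adj x y -> adj y z -> adj x z ->
    [|| adj w x, adj w y | adj w z].

Definition free_K2_2K1 (G : sgraph) : Prop :=
  forall x y z w : G, adj x y -> z != w ->
    [|| adj z w, adj x z, adj x w, adj y z | adj y w].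

Lemma matching_embeds (H G : sgraph) : embeds H G -> matching G -> matching H.
Proof.
move=> [f [inj_f mono_f]] P x y z; rewrite -!mono_f => xy xz.
exact/inj_f/(P (f x)).
Qed.

Lemma triangle_free_embeds (H G : sgraph) :
  embeds H G -> triangle_free G -> triangle_free H.
Proof. by move=> [f [_ mono_f]] P x y z; rewrite -!mono_f; apply: P. Qed.

Lemma P3_free_embeds (H G : sgraph) : embeds H G -> P3_free G -> P3_free H.
Proof.
by move=> [f [inj_f mono_f]] P x y z; rewrite -!mono_f -(inj_eq inj_f); apply: P.
Qed.

Lemma free_3K1_embeds (H G : sgraph) : embeds H G -> free_3K1 G -> free_3K1 H.
Proof.
move=> [f [inj_f mono_f]] P x y z; rewrite -!mono_f -!(inj_eq inj_f).
exact: P.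
Qed.

Lemma free_2K2_embeds (H G : sgraph) : embeds H G -> free_2K2 G -> free_2K2 H.
Proof. by move=> [f [_ mono_f]] P x y z w; rewrite -!mono_f; apply: P. Qed.

Lemma free_K3_K1_embeds (H G : sgraph) :
  embeds H G -> free_K3_K1 G -> free_K3_K1 H.
Proof. by move=> [f [_ mono_f]] P x y z w; rewrite -!mono_f; apply: P. Qed.

Lemma free_K2_2K1_embeds (H G : sgraph) :
  embeds H G -> free_K2_2K1 G -> free_K2_2K1 H.
Proof.
move=> [f [inj_f mono_f]] P x y z w; rewrite -!mono_f -(inj_eq inj_f).
exact: P.
Qed.

(** Let x be an end of an edge if there is one.  Maximum degree 1 leaves x at
most one neighbour.  Two non-neighbours of x would be adjacent by the absence of
3K1, and their edge together with the edge at x would be a 2K2; so x has at most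
one non-neighbour.  Sending x and its neighbour to the edge and its
non-neighbour to the isolated vertex is an embedding. *)
Lemma embeds_co_P3 (H : sgraph) :
  matching H -> free_3K1 H -> free_2K2 H -> embeds H K2_plus_K1.
Proof.
move=> match_H no3K1 no2K2.
suff main (x : H) : (forall z w : H, adj z w -> exists y, adj x y) ->
    embeds H K2_plus_K1.
  have [x /existsP x_edge|noedge] := pickP (fun x : H => [exists y, adj x y]).
    by apply: (main x) => _ _ _.
  have [x _|empty] := pickP (@predT H).
    apply: (main x) => z w zw; have /existsP[] := noedge z.
    by exists w.
  have absurd (x : H) : False by have := empty x.
  exists (fun x => match absurd x with end); split=> x; by have := absurd x.
move=> x_edge.
have nonadj_eq u v : u != x -> v != x -> ~~ adj x u -> ~~ adj x v -> u = v.
  move=> ux vx xu xv; apply/eqP; apply: contraT => uv.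
  have := no3K1 x u v; rewrite ![x == _]eq_sym (negPf xu) (negPf xv) /=.
  move=> /(_ ux vx uv) adj_uv; have [y xy] := x_edge _ _ adj_uv.
  (* The only neighbour of y is x, so the edges xy and uv form a 2K2. *)
  have yN z : z != x -> adj y z = false.
    apply: contraNF => yz; apply/eqP; apply/esym/(match_H y) => //.
    by rewrite adj_sym.
  by have := no2K2 _ _ _ _ xy adj_uv; rewrite (negPf xu) (negPf xv) !yN.
have adj_only u v : v != x -> adj x u -> adj u v = false.
  move=> vx xu; apply: contraNF vx => uv; apply/eqP/esym/(match_H u) => //.
  by rewrite adj_sym.
pose f v : K2_plus_K1 :=
  if v == x then inl ord0 else if adj x v then inl ord_max else inr ord0.
exists f; split=> [u v|u v]; rewrite /f.
  case: (eqVneq u x) => [->|ux]; case: (eqVneq v x) => [->|vx] //.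
  - by case: ifP.
  - by case: ifP.
  case: ifP => xu; case: ifP => xv // _; first exact: match_H xu xv.
  by apply: nonadj_eq; rewrite ?xu ?xv.
case: (eqVneq u x) => [->|ux]; case: (eqVneq v x) => [->|vx] //.
- by rewrite !adj_irr.
- by case: (adj x v).
- by rewrite [RHS]adj_sym; case: (adj x u).
case: ifP => xu; case: ifP => xv.
- by rewrite adj_only.
- by rewrite adj_only.
- by rewrite [RHS]adj_sym adj_only.
- by rewrite (nonadj_eq u v) ?xu ?xv // !adj_irr.
Qed.

(** * The six arrangements *)

(** Under two_cliques the ends of the edges form one clique and the vertices None
the other; under one_clique the vertices None are isolated.  Under across, the
bipartition separates the vertices Some true from all the others, and the pairs
missing between its sides are those of Some true and None in the same copy.
The relation fibre_adj itself joins the copies of the edge into a complete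
bipartite graph. *)
Definition apart : rel (option bool) := fun _ _ => false.
Definition joined : rel (option bool) := fun _ _ => true.
Definition two_cliques : rel (option bool) := fun s t => isSome s == isSome t.
Definition one_clique : rel (option bool) := fun s t => isSome s && isSome t.
Definition across : rel (option bool) := fun s t => (s == Some true) != (t == Some true).

Lemma apart_sym : symmetric apart. Proof. by []. Qed.
Lemma joined_sym : symmetric joined. Proof. by []. Qed.
Lemma two_cliques_sym : symmetric two_cliques.
Proof. by move=> s t; apply: eq_sym. Qed.
Lemma one_clique_sym : symmetric one_clique.
Proof. by move=> s t; apply: andbC. Qed.
Lemma fibre_sym : symmetric fibre_adj.
Proof. by move=> [[]|] [[]|]. Qed.
Lemma across_sym : symmetric across.
Proof. by move=> s t; rewrite /across eq_sym. Qed.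

(** Adjacency in an arrangement depends only on the types of the vertices and on
which of their copies coincide, so a statement about boundedly many vertices is
a finite check over these data.  The recorded inequalities discard the patterns
that contradict the transitivity of equality. *)
Ltac index_cases := rewrite /= /copies_adj /= ?xpair_eqE /=;
  repeat match goal with
  | |- context [@eq_op _ ?i ?i] => rewrite (eqxx i)
  | |- context [@eq_op _ ?i ?j] => is_var i; is_var j;
      first [match goal with
        | ne : is_true (i != j) |- _ => rewrite (negPf ne)
        | ne : is_true (j != i) |- _ => rewrite [i == j]eq_sym (negPf ne)
        end
      | case: (eqVneq i j) => [?|?]; [subst |]]
  end; rewrite //=.

Section Arrangements.
Variable n : nat.

Lemma apart_matching : matching (copies n apart_sym).
Proof. by move=> [i [[]|]] [j [[]|]] [k [[]|]]; index_cases. Qed.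

Lemma joined_free_3K1 : free_3K1 (copies n joined_sym).
Proof. by move=> [i [[]|]] [j [[]|]] [k [[]|]]; index_cases. Qed.

Lemma joined_free_2K2 : free_2K2 (copies n joined_sym).
Proof. by move=> [i [[]|]] [j [[]|]] [k [[]|]] [l [[]|]]; index_cases. Qed.

Lemma joined_free_K3_K1 : free_K3_K1 (copies n joined_sym).
Proof. by move=> [i [[]|]] [j [[]|]] [k [[]|]] [l [[]|]]; index_cases. Qed.

Lemma two_cliques_P3_free : P3_free (copies n two_cliques_sym).
Proof. by move=> [i [[]|]] [j [[]|]] [k [[]|]]; index_cases. Qed.

Lemma two_cliques_free_3K1 : free_3K1 (copies n two_cliques_sym).
Proof. by move=> [i [[]|]] [j [[]|]] [k [[]|]]; index_cases. Qed.

Lemma one_clique_P3_free : P3_free (copies n one_clique_sym).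
Proof. by move=> [i [[]|]] [j [[]|]] [k [[]|]]; index_cases. Qed.

Lemma one_clique_free_2K2 : free_2K2 (copies n one_clique_sym).
Proof. by move=> [i [[]|]] [j [[]|]] [k [[]|]] [l [[]|]]; index_cases. Qed.

Lemma fibre_triangle_free : triangle_free (copies n fibre_sym).
Proof. by move=> [i [[]|]] [j [[]|]] [k [[]|]]; index_cases. Qed.

Lemma fibre_free_2K2 : free_2K2 (copies n fibre_sym).
Proof. by move=> [i [[]|]] [j [[]|]] [k [[]|]] [l [[]|]]; index_cases. Qed.

Lemma across_triangle_free : triangle_free (copies n across_sym).
Proof. by move=> [i [[]|]] [j [[]|]] [k [[]|]]; index_cases. Qed.

Lemma across_free_K2_2K1 : free_K2_2K1 (copies n across_sym).
Proof. by move=> [i [[]|]] [j [[]|]] [k [[]|]] [l [[]|]]; index_cases. Qed.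

End Arrangements.

(** * The case analysis *)

Lemma matching_of_P3_triangle_free (H : sgraph) :
  P3_free H -> triangle_free H -> matching H.
Proof.
move=> noP3 noK3 x y z xy xz; apply/eqP; have yx : adj y x by rewrite adj_sym.
by have := noP3 _ _ _ yx xz; rewrite (negPf (noK3 _ _ _ yx xz)) orbF.
Qed.

(** Components of a P3-free graph are cliques, and the absence of K3 + K1 puts
every vertex in the component of the triangle. *)
Lemma complete_of_triangle (H : sgraph) (x y z : H) :
  P3_free H -> free_K3_K1 H -> adj x y -> adj y z -> adj x z -> is_complete H.
Proof.
move=> noP3 noK3K1 xy yz xz.
have to_x u : (u == x) || adj u x.
  have /or3P[->|uy|uz] := noK3K1 _ _ _ u xy yz xz; first by rewrite orbT.
    by apply: noP3 uy _; rewrite adj_sym.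
  by apply: noP3 uz _; rewrite adj_sym.
move=> u v uv; have /predU1P[ux|ux] := to_x u.
  have := to_x v; rewrite -ux eq_sym (negPf uv) /=.
  by rewrite adj_sym.
have /predU1P[-> //|vx] := to_x v.
by have := noP3 u x v ux; rewrite (negPf uv) adj_sym; apply.
Qed.

(** Suppose xy is an edge, necessarily a component.  Two distinct non-adjacent
vertices cannot both lie on xy, nor both off it, as they would then form a
K2 + 2K1 with xy.  So xy separates each pair from a, b, c, which is impossible
for three vertices and two sides. *)
Lemma edgeless_of_stable_triple (H : sgraph) (a b c : H) :
  matching H -> free_K2_2K1 H ->
  [&& a != b, a != c, b != c, ~~ adj a b, ~~ adj a c & ~~ adj b c] ->
  is_edgeless H.
Proof.
move=> match_H noK2_2K1 /and5P[ab ac bc nab /andP[nac nbc]] x y.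
apply/negP => xy.
have yx : adj y x by rewrite adj_sym.
pose on_xy u := (u == x) || (u == y).
have separated u v : u != v -> ~~ adj u v -> on_xy u != on_xy v.
  move=> uv nuv; rewrite /on_xy.
  have [ux|ux] := eqVneq u x; have [vx|vx] := eqVneq v x => //=.
  - by rewrite ux vx eqxx in uv.
  - by apply: contraNneq nuv => /esym/eqP ->; rewrite ux.
  - by apply: contraNneq nuv => /eqP ->; rewrite vx.
  have [uy|uy] := eqVneq u y; have [vy|vy] := eqVneq v y => //=.
    by rewrite uy vy eqxx in uv.
  have no_nbr w : w != x -> w != y -> (adj x w = false) * (adj y w = false).
    move=> wx wy; split; first by apply: contraNF wy => /(match_H _ _ _ xy) ->.
    by apply: contraNF wx => /(match_H _ _ _ yx) ->.
  by have := noK2_2K1 _ _ _ _ xy uv; rewrite (negPf nuv) !no_nbr.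
move: (separated _ _ ab nab) (separated _ _ ac nac) (separated _ _ bc nbc).
by case: (on_xy a) (on_xy b) (on_xy c) => [] [] [].
Qed.

(** The asymmetric core of the necessity proof: apart contains one of the two
graphs, and calling that one H1 determines the roles of both in what follows. *)
Lemma exceptional_of_apart (H1 H2 : sgraph) (n : nat) :
  (forall (r : rel (option bool)) (r_sym : symmetric r),
    embeds H1 (copies n r_sym) \/ embeds H2 (copies n r_sym)) ->
  embeds H1 (copies n apart_sym) ->
  [\/ embeds H1 K2_plus_K1, embeds H2 K2_plus_K1 |
      is_complete H2 /\ is_edgeless H1].
Proof.
move=> hits /matching_embeds /(_ (@apart_matching n)) match_H1.
have [H1D|H2D] := hits _ joined_sym.
  constructor 1; apply: embeds_co_P3 match_H1 _ _.
    exact: free_3K1_embeds H1D (@joined_free_3K1 n).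
  exact: free_2K2_embeds H1D (@joined_free_2K2 n).
have no3K1_H2 := free_3K1_embeds H2D (@joined_free_3K1 n).
have no2K2_H2 := free_2K2_embeds H2D (@joined_free_2K2 n).
have noK3K1_H2 := free_K3_K1_embeds H2D (@joined_free_K3_K1 n).
have embeds_H2 : P3_free H2 -> triangle_free H2 -> embeds H2 K2_plus_K1.
  by move=> noP3 noK3; apply: embeds_co_P3 => //;
     apply: matching_of_P3_triangle_free.
have [/existsP[a /existsP[b /existsP[c abc]]]|no_triple] := boolP
  [exists a : H1, exists b : H1, exists c : H1,
     [&& a != b, a != c, b != c, ~~ adj a b, ~~ adj a c & ~~ adj b c]].
  have noP3_H2 : P3_free H2.
    have [H1B|H2B] := hits _ two_cliques_sym; last first.
      exact: P3_free_embeds H2B (@two_cliques_P3_free n).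
    move/and5P: abc => [ab ac bc nab /andP[nac nbc]].
    have := free_3K1_embeds H1B (@two_cliques_free_3K1 n) ab ac bc.
    by rewrite (negPf nab) (negPf nac) (negPf nbc).
  have [H1F|H2F] := hits _ across_sym; last first.
    constructor 2; apply: embeds_H2 => //.
    exact: triangle_free_embeds H2F (@across_triangle_free n).
  have edgeless_H1 : is_edgeless H1.
    apply: edgeless_of_stable_triple abc => //.
    exact: free_K2_2K1_embeds H1F (@across_free_K2_2K1 n).
  have [/existsP[x /existsP[y /existsP[z /and3P[xy yz xz]]]]|noK3] := boolP
    [exists x : H2, exists y : H2, exists z : H2,
       [&& adj x y, adj y z & adj x z]].
    by constructor 3; split=> //; apply: complete_of_triangle xy yz xz.
  constructor 2; apply: embeds_H2 => // x y z xy yz.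
  apply: contra noK3 => xz; apply/existsP; exists x; apply/existsP; exists y.
  by apply/existsP; exists z; rewrite xy yz.
have no3K1_H1 : free_3K1 H1.
  move=> a b c ab ac bc; apply: contraNT no_triple; rewrite !negb_or => nabc.
  apply/existsP; exists a; apply/existsP; exists b; apply/existsP; exists c.
  by rewrite ab ac bc.
have [H1C|H2C] := hits _ one_clique_sym.
  constructor 1; apply: embeds_co_P3 => //.
  exact: free_2K2_embeds H1C (@one_clique_free_2K2 n).
have [H1E|H2E] := hits _ fibre_sym.
  constructor 1; apply: embeds_co_P3 => //.
  exact: free_2K2_embeds H1E (@fibre_free_2K2 n).
constructor 2; apply: embeds_H2.
  exact: P3_free_embeds H2C (@one_clique_P3_free n).
exact: triangle_free_embeds H2E (@fibre_triangle_free n).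
Qed.

Lemma pair_class_sym (H1 H2 : sgraph) :
  bounded_apex_complete_multipartite (free (pair_class H1 H2)) ->
  bounded_apex_complete_multipartite (free (pair_class H2 H1)).
Proof.
move=> [c bnd]; exists c => G freeG; apply: bnd => H H12; apply: freeG.
by case: H12; [right | left].
Qed.

Theorem theorem10p2 (H1 H2 : sgraph) :
  bounded_apex_complete_multipartite (free (pair_class H1 H2)) <->
  ((induced_subgraph H1 K2_plus_K1 \/ (is_complete H1 /\ is_edgeless H2)) \/
   (induced_subgraph H2 K2_plus_K1 \/ (is_complete H2 /\ is_edgeless H1))).
Proof.
split=> [/bounded_apex_embeds_copies[n hits]|].
  have hits' r (r_sym : symmetric r) :
      embeds H2 (copies n r_sym) \/ embeds H1 (copies n r_sym).
    by have [] := hits r r_sym; [right | left].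
  have [/(exceptional_of_apart hits)|/(exceptional_of_apart hits')] := hits _ apart_sym.
    by case=> [/induced_subgraphE|/induced_subgraphE|]; tauto.
  by case=> [/induced_subgraphE|/induced_subgraphE|]; tauto.
case=> [[/induced_subgraphE|[]]|[/induced_subgraphE|[]]].
- exact: bounded_apex_of_sub_co_P3.
- exact: bounded_apex_of_complete_edgeless.
- by move=> /bounded_apex_of_sub_co_P3 bnd; apply: pair_class_sym.
- by move=> ? ?; apply/pair_class_sym/bounded_apex_of_complete_edgeless.
Qed.
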